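(* There is a constant $c\in\mathbb{R}_{>0}$ such that for every positive integer $n$ and every (not necessarily finite) group $G$ with $|\mathcal{C}(G)|=n$, one has $$n\le |G:Z(G)|\le c^{\,n-1},$$ where $Z(G)$ is the center of $G$.
   Context: For a group $G$, $\mathcal{C}(G)=\{C_G(x) : x\in G\}$ denotes the set of centralizers of elements of $G$, where $C_G(x)=\{g\in G: gx=xg\}$. A group $G$ is called a $\mathcal{C}_n$-group if $|\mathcal{C}(G)|=n$. *)

(* Defs.v *)
From Stdlib Require Import Reals List.
Import ListNotations.

Record Group : Type := MkGroup {
  carrier :> Type;
  gmul : carrier -> carrier -> carrier;
  ginv : carrier -> carrier;
  gone : carrier;
  gmul_assoc : forall x y z, gmul x (gmul y z) = gmul (gmul x y) z;
  gmul_1l : forall x, gmul gone x = x;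
  gmul_Vl : forall x, gmul (ginv x) x = gone
}.

Definition centralizer (G : Group) (x : G) : G -> Prop :=
  fun g => gmul G g x = gmul G x g.

Definition same_set (G : Group) (A B : G -> Prop) : Prop :=
  forall g, A g <-> B g.

Definition num_centralizers (G : Group) (n : nat) : Prop :=
  exists xs : list G,
    length xs = n /\
    (forall i j, (i < n)%nat -> (j < n)%nat -> i <> j ->
       forall d : G, ~ same_set G (centralizer G (nth i xs d)) (centralizer G (nth j xs d))) /\
    (forall y : G, exists x, In x xs /\ same_set G (centralizer G y) (centralizer G x)).

Definition center (G : Group) : G -> Prop :=
  fun z => forall g : G, gmul G z g = gmul G g z.

Definition center_index (G : Group) (k : nat) : Prop :=
  exists reps : list G,
    length reps = k /\
    (forall i j, (i < k)%nat -> (j < k)%nat -> i <> j ->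
       forall d : G, ~ center G (gmul G (ginv G (nth i reps d)) (nth j reps d))) /\
    (forall g : G, exists r, In r reps /\ center G (gmul G (ginv G r) g)).

(* Main.v *)
(** If [g], [h] and [g t], [h t] have pairwise equal centralizers, then [g] and
    [h] commute, [g t] and [h t] commute, and so [h g^-1] commutes with [t].
    Hence, if the elements of a list [ts] are centralized simultaneously only by
    [Z(G)], the coset of [g] modulo [Z(G)] is determined by the centralizers of
    [g] and of the [g t], whence [|G : Z(G)| <= n ^ (|ts| + 1)].

    Taking for [ts] a representative of every centralizer shows that the index
    is finite.  By pigeonhole, at least [1 / n] of the cosets of [Z(G)] consist
    of elements with the same centralizer as some [x], so the double centralizer
    of [x] has index at most [n].  Adding to [x] an element outside of the
    current double centralizer at least doubles the latter, so at most [log2 n]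
    additions are needed.  Thus [|G : Z(G)| <= n ^ (log2 n + 2)], which is at
    most [64 ^ (n - 1)]. *)

Require Import Defs.
From Stdlib Require Import Reals List Lia Classical ClassicalEpsilon.
Import ListNotations.
Open Scope nat_scope.

(** * Pigeonhole for lists, and maxima of bounded sets of naturals *)

Section Pigeonhole.

Context {A B : Type}.

Lemma pigeonhole_fiber (f : A -> B) (bs : list B) (l : list A) :
  NoDup l -> (forall a, In a l -> In (f a) bs) ->
  exists l', NoDup l' /\ incl l' l /\
    (forall a b, In a l' -> In b l' -> f a = f b) /\
    length l <= length bs * length l'.
Proof.
revert l; induction bs as [|b bs IH]; intros l Hnd Hl.
- exists []; repeat split; [constructor | easy | easy |].
  destruct l as [|a l]; [easy | destruct (Hl a); now left].
- set (p := fun a => if excluded_middle_informative (f a = b) then true else false).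
  assert (Hp : forall a, p a = true <-> f a = b).
  { intros a; unfold p; destruct excluded_middle_informative; easy. }
  pose proof (filter_length p l) as Hlen.
  destruct (IH (filter (fun a => negb (p a)) l)) as (l2 & Hnd2 & Hin2 & Hc2 & Hl2).
  + now apply NoDup_filter.
  + intros a Ha; apply filter_In in Ha as [Ha Hpa].
    destruct (Hl a Ha) as [E|]; [|easy].
    symmetry in E; apply Hp in E; now rewrite E in Hpa.
  (* Keep the longer of the fiber over [b] and the best fiber over [bs]. *)
  + destruct (Nat.le_gt_cases (length (filter p l)) (length l2)).
    * exists l2; repeat split; [easy | | easy | simpl; lia].
      intros a Ha; apply Hin2, filter_In in Ha; easy.
    * exists (filter p l); repeat split.
      -- now apply NoDup_filter.
      -- apply incl_filter.
      -- intros a c Ha Hc; apply filter_In in Ha as [_ Ha], Hc as [_ Hc].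
         apply Hp in Ha, Hc; congruence.
      -- simpl; nia.
Qed.

(** Refine by one function at a time; each costs a factor [length bs]. *)
Lemma pigeonhole_fibers (fs : list (A -> B)) (bs : list B) (l : list A) :
  NoDup l -> (forall f a, In f fs -> In (f a) bs) ->
  exists l', NoDup l' /\ incl l' l /\
    (forall f a b, In f fs -> In a l' -> In b l' -> f a = f b) /\
    length l <= length bs ^ length fs * length l'.
Proof.
intros Hnd; induction fs as [|f fs IH]; intros Hfs.
- exists l; repeat split; [easy | easy | easy | simpl; lia].
- destruct IH as (l1 & Hnd1 & Hin1 & Hc1 & Hl1).
  { intros g a Hg; apply Hfs; now right. }
  destruct (pigeonhole_fiber f bs l1) as (l2 & Hnd2 & Hin2 & Hc2 & Hl2); [easy | |].
  { intros a _; apply Hfs; now left. }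
  exists l2; repeat split; [easy | | |].
  + eapply incl_tran; eassumption.
  + intros g a b [<-|Hg] Ha Hb; auto.
  + simpl; apply (Nat.mul_le_mono_l _ _ (length bs ^ length fs)) in Hl2; nia.
Qed.

End Pigeonhole.

Lemma exists_max_nat (P : nat -> Prop) (b m : nat) :
  P m -> (forall i, P i -> i <= b) -> exists k, P k /\ forall i, P i -> i <= k.
Proof.
intros Pm Hb; revert m Pm.
enough (H : forall e m, P m -> b <= m + e -> exists k, P k /\ forall i, P i -> i <= k).
{ intros m Pm; apply (H b m Pm); lia. }
induction e as [|e IH]; intros m Pm He.
- exists m; split; [easy | intros i Hi; apply Hb in Hi; lia].
- destruct (classic (exists i, P i /\ m < i)) as [(i & Pi & Hi)|Hno].
  + apply (IH i Pi); lia.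
  + exists m; split; [easy | intros i Pi].
    destruct (Nat.le_gt_cases i m); [easy | destruct Hno; now exists i].
Qed.

(** * Group identities, commutation and central cosets *)

Section CentralizerIndex.

Context {G : Group}.
Local Notation "x ** y" := (gmul G x y) (at level 40, left associativity).
Local Notation inv := (ginv G).
Local Notation one := (gone G).

Lemma mul_invr (x : G) : x ** inv x = one.
Proof.
rewrite <- (gmul_1l G (x ** inv x)), <- (gmul_Vl G (inv x)) at 1.
rewrite <- gmul_assoc, (gmul_assoc G (inv x) x), gmul_Vl, gmul_1l.
apply gmul_Vl.
Qed.

Lemma mul_1r (x : G) : x ** one = x.
Proof. now rewrite <- (gmul_Vl G x), gmul_assoc, mul_invr, gmul_1l. Qed.

Lemma mulK (x y : G) : x ** y ** inv y = x.
Proof. now rewrite <- gmul_assoc, mul_invr, mul_1r. Qed.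

Lemma mulVK (x y : G) : x ** inv y ** y = x.
Proof. now rewrite <- gmul_assoc, gmul_Vl, mul_1r. Qed.

Lemma mulKV (x y : G) : inv x ** (x ** y) = y.
Proof. now rewrite gmul_assoc, gmul_Vl, gmul_1l. Qed.

Lemma mulVKV (x y : G) : x ** (inv x ** y) = y.
Proof. now rewrite gmul_assoc, mul_invr, gmul_1l. Qed.

Lemma mulI (x y z : G) : x ** y = x ** z -> y = z.
Proof. intros E; now rewrite <- (mulKV x y), E, mulKV. Qed.

Lemma mulIr (x y z : G) : y ** x = z ** x -> y = z.
Proof. intros E; now rewrite <- (mulK y x), E, mulK. Qed.

Lemma inv_mul (x y : G) : inv (x ** y) = inv y ** inv x.
Proof.
apply (mulIr (x ** y)); rewrite gmul_Vl.
now rewrite gmul_assoc, mulVK, gmul_Vl.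
Qed.

Lemma inv_inv (x : G) : inv (inv x) = x.
Proof. apply (mulIr (inv x)); now rewrite gmul_Vl, mul_invr. Qed.

Definition commute (x y : G) : Prop := x ** y = y ** x.

Lemma commute_mul (g x y : G) : commute g x -> commute g y -> commute g (x ** y).
Proof.
unfold commute; intros Hx Hy.
now rewrite gmul_assoc, Hx, <- gmul_assoc, Hy, gmul_assoc.
Qed.

Lemma commute_inv (g x : G) : commute g x -> commute g (inv x).
Proof.
unfold commute; intros H; apply (mulI x), (mulIr x).
now rewrite mulVKV, gmul_assoc, mulVK.
Qed.

Lemma center_inv (z : G) : center G z -> center G (inv z).
Proof. intros H g; symmetry; apply commute_inv; symmetry; apply H. Qed.

Lemma center_div_sym (a b : G) : center G (inv a ** b) -> center G (inv b ** a).
Proof. intros H%center_inv; now rewrite inv_mul, inv_inv in H. Qed.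

(** Passes from the right quotients that commutation arguments produce to the left quotients that
    define cosets here. *)
Lemma center_div_flip (a b : G) : center G (b ** inv a) -> center G (inv a ** b).
Proof.
intros H; replace (inv a ** b) with (b ** inv a); [easy|].
apply (mulI a); rewrite mulVKV, <- (H a); apply mulVK.
Qed.

Lemma centralizer_center_coset (a b : G) :
  center G (inv a ** b) -> same_set G (centralizer G a) (centralizer G b).
Proof.
intros H; assert (Hb : b = a ** (inv a ** b)) by now rewrite mulVKV.
revert H Hb; generalize (inv a ** b); intros z Hz -> g; unfold centralizer; split.
- intros Hg; apply commute_mul; [easy | symmetry; apply Hz].
- intros Hg; rewrite <- (mulK a z).
  apply commute_mul; [easy | apply commute_inv; symmetry; apply Hz].
Qed.

Lemma same_centralizers_commute (g h t : G) :
  same_set G (centralizer G g) (centralizer G h) ->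
  same_set G (centralizer G (g ** t)) (centralizer G (h ** t)) ->
  commute (h ** inv g) t.
Proof.
intros Eg Et.
assert (Hgh : commute g h) by (apply Eg; reflexivity).
assert (Hgt : commute (g ** t) (h ** t)) by (apply Et; reflexivity).
assert (Hu : commute g (h ** inv g)) by (apply commute_mul; [easy | now apply commute_inv]).
(* The quotient of [h ** t] by [g ** t] is again [h ** inv g], which thus commutes with both [g] and
   [g ** t], hence with [t]. *)
assert (Hv : commute (g ** t) (h ** inv g)).
{ replace (h ** inv g) with ((h ** t) ** inv (g ** t)).
  - apply commute_mul; [easy | now apply commute_inv].
  - now rewrite inv_mul, gmul_assoc, mulK. }
assert (Ht : commute (h ** inv g) (inv g ** (g ** t))).
{ apply commute_mul; [apply commute_inv|]; now symmetry. }
now rewrite mulKV in Ht.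
Qed.

(** A partial transversal of the cosets of the center. *)
Definition center_indep (l : list G) : Prop :=
  NoDup l /\ forall a b, In a l -> In b l -> center G (inv a ** b) -> a = b.

Definition center_separates (ts : list G) : Prop :=
  forall g, (forall t, In t ts -> commute g t) -> center G g.

Definition double_centralizer (ts : list G) (y : G) : Prop :=
  forall g, (forall t, In t ts -> commute g t) -> commute g y.

(** * Growing partial transversals inside double centralizers *)

Lemma center_indep_incl (l l' : list G) :
  NoDup l' -> incl l' l -> center_indep l -> center_indep l'.
Proof. intros Hnd Hi [_ H]; split; [easy | intros a b Ha Hb; apply H; auto]. Qed.

(** The double centralizer is a subgroup D containing the center, so the cosets of [l] lie in D and
    those of its translate by [t] lie in the disjoint coset tD. *)
Lemma center_indep_double (ts l : list G) (t : G) :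
  center_indep l -> (forall a, In a l -> double_centralizer ts a) ->
  ~ double_centralizer ts t ->
  center_indep (l ++ map (gmul G t) l).
Proof.
intros [Hnd Hind] Hl Ht.
assert (Hsep : forall a b, In a l -> In b l -> ~ center G (inv a ** (t ** b))).
{ intros a b Ha Hb Hz; apply Ht.
  replace t with (a ** (inv a ** (t ** b)) ** inv b) by now rewrite mulVKV, mulK.
  intros g Hg; apply commute_mul; [apply commute_mul|].
  - now apply Hl.
  - symmetry; apply Hz.
  - apply commute_inv; now apply Hl. }
split.
- apply NoDup_app; [easy | |].
  + apply NoDup_map_NoDup_ForallPairs; [|easy].
    intros a b _ _; apply mulI.
  + intros a Ha (b & <- & Hb)%in_map_iff.
    apply (Hsep _ b Ha Hb); rewrite gmul_Vl.
    intros g; now rewrite gmul_1l, mul_1r.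
- intros a b [Ha|(a' & <- & Ha)%in_map_iff]%in_app_iff
    [Hb|(b' & <- & Hb)%in_map_iff]%in_app_iff Hz.
  + now apply Hind.
  + destruct (Hsep a b' Ha Hb Hz).
  + destruct (Hsep b a' Hb Ha); now apply center_div_sym.
  + f_equal; apply Hind; [easy | easy |].
    now rewrite inv_mul, <- gmul_assoc, mulKV in Hz.
Qed.

(** Without such [us], doubling could be repeated forever: it stops only when the double centralizer
    is all of G, and then the list separates. *)
Lemma log_many_extend_to_separating (ts l : list G) (k : nat) :
  0 < length l -> center_indep l ->
  (forall a, In a l -> double_centralizer ts a) ->
  (forall l', center_indep l' -> length l' <= k) ->
  exists us, center_separates (us ++ ts) /\ 2 ^ length us * length l <= k.
Proof.
intros Hpos Hl Hts Hk; apply NNPP; intros Hno.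
assert (H : forall d, exists us l', length us = d /\ center_indep l' /\
  length l' = 2 ^ d * length l /\ forall a, In a l' -> double_centralizer (us ++ ts) a).
{ induction d as [|d (us & l' & Hus & Hl' & Hlen & Hd)].
  - exists [], l; repeat split; [apply Hl | apply Hl | simpl; lia | easy].
  - destruct (classic (exists t, ~ double_centralizer (us ++ ts) t)) as [[t Ht]|Hall].
    + assert (Hmon : forall a,
        double_centralizer (us ++ ts) a -> double_centralizer (t :: us ++ ts) a).
      { intros a Ha g Hg; apply Ha; intros u Hu; apply Hg; now right. }
      exists (t :: us), (l' ++ map (gmul G t) l'); split; [simpl; lia|].
      split; [now apply center_indep_double with (us ++ ts)|].
      split; [rewrite length_app, length_map; simpl; lia|].
      intros a [Ha|(b & <- & Hb)%in_map_iff]%in_app_iff; [now apply Hmon, Hd|].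
      intros g Hg; apply commute_mul; [apply Hg; now left | now apply Hmon; auto].
    + destruct Hno; exists us; split.
      * intros g Hg y; apply NNPP; intros Hy; apply Hall.
        exists y; intros Hy'; now apply Hy, Hy'.
      * rewrite Hus, <- Hlen; now apply Hk. }
(* After [k] doublings the length is at least 2^k, which exceeds [k]. *)
destruct (H k) as (us & l' & _ & Hl' & Hlen & _); apply Hk in Hl'.
pose proof (Nat.pow_gt_lin_r 2 k); nia.
Qed.

Lemma center_index_of_max (l : list G) :
  center_indep l -> (forall l', center_indep l' -> length l' <= length l) ->
  center_index G (length l).
Proof.
intros [Hnd Hind] Hmax; exists l; split; [easy | split].
- intros i j Hi Hj Hij d Hz; apply Hij.
  apply (proj1 (NoDup_nth l d) Hnd); [easy | easy |].
  apply Hind; [now apply nth_In | now apply nth_In | easy].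
- intros g; apply NNPP; intros Hno.
  assert (Hg : forall r, In r l -> ~ center G (inv r ** g)).
  { intros r Hr Hz; apply Hno; now exists r. }
  (* An element outside all cosets of [l] would extend [l], against maximality. *)
  enough (H : center_indep (g :: l)) by (apply Hmax in H; simpl in H; lia).
  split.
  + constructor; [|easy]; intros Hin; apply (Hg g Hin).
    rewrite gmul_Vl; intros h; now rewrite gmul_1l, mul_1r.
  + intros a b [<-|Ha] [<-|Hb] Hz.
    * easy.
    * destruct (Hg b Hb); now apply center_div_sym.
    * now destruct (Hg a Ha).
    * now apply Hind.
Qed.

(** * Bounding the index through classes of equal centralizers *)

Section CentralizerClasses.

Variables (xs : list G) (cls : G -> G).
Hypothesis cls_in : forall g, In (cls g) xs.
Hypothesis cls_same : forall g, same_set G (centralizer G g) (centralizer G (cls g)).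

Lemma same_centralizer_of_cls (g h : G) :
  cls g = cls h -> same_set G (centralizer G g) (centralizer G h).
Proof.
intros E y; rewrite (cls_same g y), (cls_same h y), E; reflexivity.
Qed.

Lemma center_separates_classes : center_separates xs.
Proof.
intros g Hg y; apply (cls_same y), Hg, cls_in.
Qed.

Lemma center_indep_length (ts l : list G) :
  center_separates ts -> center_indep l -> length l <= length xs ^ S (length ts).
Proof.
intros Hts Hl.
(* Elements with the same classes for all these functions share a central coset, so the common fiber
   [l'] has at most one element. *)
destruct (pigeonhole_fibers (cls :: map (fun t g => cls (g ** t)) ts) xs l)
  as (l' & Hnd & Hin & Hc & Hlen).
- apply Hl.
- intros f a [<-|(t & <- & _)%in_map_iff]; apply cls_in.
- assert (Heq : forall a b, In a l' -> In b l' -> a = b).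
  { intros a b Ha Hb; apply Hl; [auto | auto |].
    apply center_div_flip, Hts; intros t Ht.
    apply same_centralizers_commute; apply same_centralizer_of_cls.
    - apply Hc; [now left | easy | easy].
    - apply (Hc (fun g => cls (g ** t))); [|easy | easy].
      right; apply in_map_iff; now exists t. }
  assert (length l' <= 1).
  { destruct l' as [|a [|b l']]; simpl; [lia | lia |].
    inversion Hnd as [|? ? Hn]; destruct Hn.
    rewrite (Heq a b); simpl; auto. }
  simpl in Hlen |- *; rewrite length_map in Hlen; nia.
Qed.

Lemma center_index_classes :
  center_indep xs ->
  exists k d, center_index G k /\ length xs <= k /\
    2 ^ d <= length xs /\ k <= length xs ^ (d + 2).
Proof.
intros Hxs.
(* The crude bound from [ts := xs] serves only to make a longest independent list exist. *)
destruct (exists_max_nat (fun k => exists l, center_indep l /\ length l = k)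
  (length xs ^ S (length xs)) (length xs)) as (k & (l & Hl & <-) & Hmax).
- now exists xs.
- intros i (l & Hl & <-); apply center_indep_length; [|easy].
  apply center_separates_classes.
- assert (Hmax' : forall l', center_indep l' -> length l' <= length l).
  { intros l' Hl'; apply Hmax; now exists l'. }
  assert (Hn : 0 < length xs).
  { pose proof (cls_in one); destruct xs; [easy | simpl; lia]. }
  pose proof (Hmax' xs Hxs) as Hk.
  destruct (pigeonhole_fiber cls xs l) as (l' & Hnd & Hin & Hc & Hlen);
    [apply Hl | auto |].
  destruct l' as [|x l']; [simpl in Hlen; lia|].
  destruct (log_many_extend_to_separating [x] (x :: l') (length l)) as (us & Hus & Hd);
    [simpl; lia | now apply center_indep_incl with l | | easy |].
  + intros a Ha g Hg.
    apply (same_centralizer_of_cls x a); [|apply Hg; now left].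
    apply Hc; [now left | easy].
  + exists (length l), (length us); split; [now apply center_index_of_max|].
    split; [easy | split].
    (* With m the size of the fiber, 2^d * m <= k <= n * m; cancel m. *)
    * apply (Nat.mul_le_mono_pos_r _ _ (length (x :: l'))); [simpl; lia|].
      now apply Nat.le_trans with (length l).
    (* The separating list has d + 1 elements, counting [x]. *)
    * replace (length us + 2) with (S (length (us ++ [x])))
        by (rewrite length_app; simpl; lia).
      now apply center_indep_length.
Qed.

End CentralizerClasses.

End CentralizerIndex.

(** * Numerical estimates and conclusion *)

Lemma quadratic_le_exponential (e : nat) : (e + 2) * (e + 3) + 6 <= 6 * 2 ^ S e.
Proof. induction e as [|e IH]; [simpl; lia | rewrite Nat.pow_succ_r'; nia]. Qed.

(** If log2 n = e + 1, then d <= e + 1 and n < 2^(e+2), so the left side is at most 2^((e+2)(e+3)),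
    while 6(n - 1) >= 6 * 2^(e+1) - 6. Comparing exponents at e = 0 gives equality, whence 64 =
    2^6. *)
Lemma quasipolynomial_le_exponential (n d : nat) :
  0 < n -> 2 ^ d <= n -> n ^ (d + 2) <= 64 ^ (n - 1).
Proof.
intros Hn Hd; destruct (Nat.log2_spec n Hn) as [Hlo Hhi].
apply Nat.log2_le_pow2 in Hd; [|easy].
destruct (Nat.log2 n) as [|e].
- replace n with 1 by (simpl in Hhi; lia); now rewrite Nat.pow_1_l.
- pose proof (quadratic_le_exponential e) as Hq.
  apply Nat.le_trans with ((2 ^ S (S e)) ^ (d + 2)); [apply Nat.pow_le_mono_l; lia|].
  change 64 with (2 ^ 6); rewrite <- !Nat.pow_mul_r.
  apply Nat.pow_le_mono_r; [lia | nia].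
Qed.

Lemma num_centralizers_center_index (G : Group) (n : nat) :
  num_centralizers G n ->
  exists k d, center_index G k /\ n <= k /\ 2 ^ d <= n /\ k <= n ^ (d + 2).
Proof.
intros (xs & <- & Hdiff & Hcov).
pose (cls := fun g => proj1_sig (constructive_indefinite_description _ (Hcov g))).
assert (Hcls : forall g, In (cls g) xs /\
  same_set G (centralizer G g) (centralizer G (cls g))).
{ intros g; apply (proj2_sig (constructive_indefinite_description _ (Hcov g))). }
apply (center_index_classes xs cls); [apply Hcls | apply Hcls |].
assert (Hnth : forall i j, i < length xs -> j < length xs ->
  same_set G (centralizer G (nth i xs (gone G))) (centralizer G (nth j xs (gone G))) ->
  i = j).
{ intros i j Hi Hj H; destruct (Nat.eq_dec i j); [easy|].
  now destruct (Hdiff i j Hi Hj n (gone G)). }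
split.
- apply (NoDup_nth xs (gone G)); intros i j Hi Hj E; apply Hnth; [easy | easy |].
  now rewrite E.
(* A central coset has a single centralizer, so distinct centralizers need distinct cosets; this
   yields [n <= k]. *)
- intros a b (i & Hi & <-)%(In_nth _ _ (gone G)) (j & Hj & <-)%(In_nth _ _ (gone G)) Hz.
  f_equal; apply Hnth; [easy | easy |].
  now apply centralizer_center_coset.
Qed.

Open Scope R_scope.

Theorem theorem2p2 :
  exists c : R, 0 < c /\
    forall (n : nat) (G : Group),
      (0 < n)%nat ->
      num_centralizers G n ->
      exists k : nat, center_index G k /\
        (n <= k)%nat /\ INR k <= c ^ (n - 1).
Proof.
exists (INR 64); split; [apply lt_0_INR; lia|].
intros n G Hn HG.
destruct (num_centralizers_center_index G n HG) as (k & d & Hk & Hnk & Hd & Hle).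
exists k; split; [easy | split; [easy|]].
rewrite <- pow_INR; apply le_INR.
apply Nat.le_trans with (n ^ (d + 2))%nat; [easy|].
now apply quasipolynomial_le_exponential.
Qed.
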